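(* Let $M$ be an indecomposable graded Ulrich $R$-module. Then there are $n\in\mathbb Z$ and $i\in\{1,2,3,4\}$ with $M\cong L_i(n)$; that is, up to degree shift, $M\cong L_i$ for some $i=1,2,3,4$.
   Context: Let $k$ be an algebraically closed field, $\lambda\in k\setminus\{0,1\}$, $R=k[X,Y]/(f_\lambda)$ with the standard grading, $f_\lambda=XY(X-Y)(X-\lambda Y)=l_1l_2l_3l_4$ with $l_1=X$, $l_2=Y$, $l_3=X-Y$, $l_4=X-\lambda Y$, and $L_i=R/(l_i)$. Modules are finitely generated and graded, and $M(n)_i=M_{n+i}$. For a graded maximal Cohen-Macaulay (MCM) $R$-module $M$, $\mu(M)$ is the minimal number of generators and $e(M)$ is the multiplicity: the Hilbert series of $M$ has the form $H_M(t)=P_M(t)/(1-t)$ with $P_M$ a Laurent polynomial, $P_M(1)\ne0$, and $e(M)=P_M(1)$. One has $\mu(M)\le e(M)$ in general. An Ulrich module is an MCM module $M$ with $\mu(M)=e(M)$. *)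

(* Defs.v *)
From HB Require Import structures.
From mathcomp Require Import all_boot all_order all_algebra.
From mathcomp Require Import generic_quotient ring_quotient.
From mathcomp Require Import mpoly.
From mathcomp Require Import boolp.

Set Implicit Arguments.
Unset Strict Implicit.
Unset Printing Implicit Defensive.

Import GRing.Theory.

Local Open Scope ring_scope.
Local Open Scope quotient_scope.

Section PrincipalIdeal.
Variables (A : comNzRingType) (a : A).

Definition principal : {pred A} := fun x => `[< exists b, x = b * a >].

Lemma principalP x : reflect (exists b, x = b * a) (x \in principal).
Proof. exact: asboolP. Qed.

Lemma principal_zmod_closed : zmod_closed principal.
Proof.
split; first by apply/principalP; exists 0; rewrite mul0r.
move=> x y /principalP[b ->] /principalP[c ->]; apply/principalP.
by exists (b - c); rewrite mulrBl.
Qed.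

HB.instance Definition _ :=
  GRing.isZmodClosed.Build A principal principal_zmod_closed.

End PrincipalIdeal.

Section CyclicModule.
Variables (A : comNzRingType) (a : A).

(* The A-module A/(a).  No properness is required of (a). *)
Definition cyclic_module : Type := {ideal_quot (principal a)}.

HB.instance Definition _ := GRing.Zmodule.on cyclic_module.

Definition cyclic_proj (x : A) : cyclic_module := \pi_({ideal_quot (principal a)}) x.

Lemma cyclic_projB : {morph cyclic_proj : x y / x - y}.
Proof. by move=> x y; rewrite /cyclic_proj [LHS]raddfB. Qed.

Lemma cyclic_proj_surj (z : cyclic_module) : exists x, z = cyclic_proj x.
Proof. by exists (repr (z : {ideal_quot (principal a)})); rewrite /cyclic_proj reprK. Qed.

Lemma cyclic_proj_eq x y : (cyclic_proj x = cyclic_proj y) <-> (x - y \in principal a).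
Proof. by rewrite /cyclic_proj Quotient.idealrBE; split => [/eqP|/eqP]. Qed.

Lemma cyclic_proj0 : cyclic_proj 0 = 0.
Proof. by rewrite -(subrr 0) cyclic_projB subrr. Qed.

Lemma cyclic_projD : {morph cyclic_proj : x y / x + y}.
Proof.
move=> x y; rewrite -{1}[y]opprK cyclic_projB -[- y]sub0r cyclic_projB.
by rewrite cyclic_proj0 sub0r opprK.
Qed.

Definition cyclic_scale (r : A) (z : cyclic_module) : cyclic_module :=
  cyclic_proj (r * repr (z : {ideal_quot (principal a)})).

Lemma cyclic_scaleE r x : cyclic_scale r (cyclic_proj x) = cyclic_proj (r * x).
Proof.
apply/cyclic_proj_eq; rewrite -mulrBr.
have /principalP[b ->] : repr (cyclic_proj x : {ideal_quot (principal a)}) - x \in principal a.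
  by apply/cyclic_proj_eq; rewrite {1}/cyclic_proj reprK.
by apply/principalP; exists (r * b); rewrite mulrA.
Qed.

Lemma cyclic_scaleA r s z : cyclic_scale r (cyclic_scale s z) = cyclic_scale (r * s) z.
Proof. by have [x ->] := cyclic_proj_surj z; rewrite !cyclic_scaleE mulrA. Qed.

Lemma cyclic_scale1 : left_id 1 cyclic_scale.
Proof. by move=> z; have [x ->] := cyclic_proj_surj z; rewrite cyclic_scaleE mul1r. Qed.

Lemma cyclic_scaleDr : right_distributive cyclic_scale +%R.
Proof.
move=> r z w; have [x ->] := cyclic_proj_surj z; have [y ->] := cyclic_proj_surj w.
by rewrite -cyclic_projD !cyclic_scaleE mulrDr cyclic_projD.
Qed.

Lemma cyclic_scaleDl z : {morph cyclic_scale^~ z : r s / r + s}.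
Proof.
move=> r s; have [x ->] := cyclic_proj_surj z.
by rewrite !cyclic_scaleE mulrDl cyclic_projD.
Qed.

HB.instance Definition _ := GRing.Zmodule_isLmodule.Build A cyclic_module
  cyclic_scaleA cyclic_scale1 cyclic_scaleDr cyclic_scaleDl.

End CyclicModule.

Section KrullDimension.
Variable A : comNzRingType.

Definition prime_chain (d : nat) (P : 'I_d.+1 -> {pred A}) : Prop :=
  (forall i, idealr_closed (P i) /\ prime_idealr_closed (P i)) /\
  (forall i j : 'I_d.+1, (i < j)%N ->
     {subset P i <= P j} /\ exists2 x, x \in P j & x \notin P i).

Definition krull_dim (d : nat) : Prop :=
  (exists P : 'I_d.+1 -> {pred A}, prime_chain P) /\
  (forall e (P : 'I_e.+1 -> {pred A}), prime_chain P -> (e <= d)%N).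

End KrullDimension.

Section TheRing.
Variables (k : closedFieldType) (lambda : k).

Definition pX : {mpoly k[2]} := 'X_ord0.
Definition pY : {mpoly k[2]} := 'X_ord_max.

(* The forms l_1, ..., l_4, indexed from 0. *)
Definition pl (i : 'I_4) : {mpoly k[2]} :=
  tnth [tuple pX; pY; pX - pY; pX - lambda *: pY] i.

Definition pf : {mpoly k[2]} := pX * pY * (pX - pY) * (pX - lambda *: pY).

Definition pf_ideal : {pred {mpoly k[2]}} := principal pf.

Lemma pf_ideal_closed : idealr_closed pf_ideal.
Proof.
split; first exact: (principal_zmod_closed pf).1.
  apply/negP => /principalP[b] /(congr1 (fun p => p.@[fun=> 0])).
  rewrite /pf /pX rmorph1 !rmorphM /= mevalXU !mul0r mulr0 => /eqP.
  by rewrite oner_eq0.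
move=> c x y /principalP[u ->] /principalP[v ->]; apply/principalP.
by exists (c * u + v); rewrite mulrDl mulrA.
Qed.

HB.instance Definition _ := isIdealr.Build {mpoly k[2]} pf_ideal pf_ideal_closed.

Definition Rf : Type := {ideal_quot pf_ideal}.
HB.instance Definition _ := GRing.ComNzRing.on Rf.

Definition toR (p : {mpoly k[2]}) : Rf := \pi_({ideal_quot pf_ideal}) p.

Lemma toR_is_zmod_morphism : zmod_morphism toR.
Proof. by move=> p q; rewrite /toR [LHS]rmorphB. Qed.
HB.instance Definition _ :=
  GRing.isZmodMorphism.Build {mpoly k[2]} Rf toR toR_is_zmod_morphism.

Lemma toR_is_monoid_morphism : monoid_morphism toR.
Proof.
by split => [|p q]; rewrite /toR; [exact: rmorph1 | exact: rmorphM].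
Qed.
HB.instance Definition _ :=
  GRing.isMonoidMorphism.Build {mpoly k[2]} Rf toR toR_is_monoid_morphism.

Lemma toR_surj (r : Rf) : exists p, r = toR p.
Proof. by exists (repr (r : {ideal_quot pf_ideal})); rewrite /toR reprK. Qed.

Lemma toR_eq0 p : toR p = 0 <-> exists q, p = q * pf.
Proof.
rewrite -(rmorph0 toR) /toR; split => [/eqP|[q ->]].
  by rewrite -Quotient.idealrBE subr0 => /principalP.
by apply/eqP; rewrite -Quotient.idealrBE subr0; apply/principalP; exists q.
Qed.

Definition Rpart (d : nat) : {pred Rf} :=
  fun r => `[< exists2 p, p \is d.-homog & r = toR p >].

(* The graded maximal ideal (x, y) of R; depth is taken with respect to it. *)
Definition Rmax : {pred Rf} :=
  fun r => `[< exists a b, r = a * toR pX + b * toR pY >].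

End TheRing.

Arguments toR {k} lambda p.
Arguments Rpart {k} lambda d.
Arguments Rmax {k} lambda.

Record gradedModule (k : closedFieldType) (lambda : k) := GradedModule {
  gmod :> lmodType (Rf lambda);
  gpart : int -> {pred gmod};
  gpart_zmod_closed : forall n, zmod_closed (gpart n);
  gpart_scale : forall (d : nat) (n : int) a z,
    a \in Rpart lambda d -> z \in gpart n -> a *: z \in gpart (d%:Z + n);
  gpart_span : forall z, exists (s : seq int) (z_ : int -> gmod),
    (forall n, z_ n \in gpart n) /\ z = \sum_(n <- s) z_ n;
  gpart_direct : forall (s : seq int) (z_ : int -> gmod), uniq s ->
    (forall n, z_ n \in gpart n) -> \sum_(n <- s) z_ n = 0 ->
    forall n, n \in s -> z_ n = 0
}.

Arguments gpart {k lambda} g n : rename.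
Arguments gpart_zmod_closed {k lambda} g n : rename.

Section GradedModules.
Variables (k : closedFieldType) (lambda : k).
Implicit Types M N : gradedModule lambda.

Section Shift.
Variables (M : gradedModule lambda) (n : int).

Definition shift_part (i : int) : {pred M} := gpart M (n + i).

Lemma shift_scale (d : nat) (i : int) a z :
  a \in Rpart lambda d -> z \in shift_part i -> a *: z \in shift_part (d%:Z + i).
Proof. by move=> aR zM; rewrite /shift_part addrCA; apply: gpart_scale. Qed.

Lemma shift_span (z : M) : exists (s : seq int) (z_ : int -> M),
  (forall i, z_ i \in shift_part i) /\ z = \sum_(i <- s) z_ i.
Proof.
have [s [z_ [zP ->]]] := gpart_span z.
exists [seq i - n | i <- s], (fun i => z_ (n + i)).
split=> [i|]; first exact: zP.
by rewrite big_map; apply: eq_bigr => i _; rewrite addrCA subrr addr0.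
Qed.

Lemma shift_direct (s : seq int) (z_ : int -> M) : uniq s ->
  (forall i, z_ i \in shift_part i) -> \sum_(i <- s) z_ i = 0 ->
  forall i, i \in s -> z_ i = 0.
Proof.
move=> us zP sum0 i si.
have := @gpart_direct _ _ M [seq n + j | j <- s] (fun j => z_ (j - n)).
rewrite map_inj_uniq // => [/(_ us)|]; last exact: addrI.
have E j : z_ (n + j - n) = z_ j by rewrite addrAC subrr add0r.
move/(_ _ _ (n + i)); rewrite E; apply => [j||].
- by have := zP (j - n); rewrite /shift_part addrCA subrr addr0.
- by rewrite big_map; under eq_bigr do rewrite E.
- exact: map_f.
Qed.

Definition shift : gradedModule lambda :=
  @GradedModule _ _ M shift_part (fun i => gpart_zmod_closed M (n + i))
    shift_scale shift_span shift_direct.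

End Shift.

Definition graded_iso M N : Prop :=
  exists phi : {linear M -> N}, bijective phi /\
    forall n z, (z \in gpart M n) = (phi z \in gpart N n).

Definition generates M (m : nat) (v : 'I_m -> M) : Prop :=
  forall z, exists c : 'I_m -> Rf lambda, z = \sum_i c i *: v i.

Definition finitely_generated M : Prop :=
  exists m (v : 'I_m -> M), generates v.

Definition min_number_generators M (m : nat) : Prop :=
  (exists v : 'I_m -> M, generates v) /\
  (forall e (v : 'I_e -> M), generates v -> (m <= e)%N).

Section Depth.
Variables (M : gradedModule lambda) (d : nat) (x : 'I_d -> Rf lambda).

(* The submodule (x_j : j < i)M. *)
Definition initial_mul (i : nat) (z : M) : Prop :=
  exists w : 'I_d -> M, z = \sum_(j < d | (j < i)%N) x j *: w j.

Definition regular_sequence : Prop :=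
  [/\ forall i, x i \in Rmax lambda,
      forall (i : 'I_d) z, initial_mul i (x i *: z) -> initial_mul i z
    & exists z, ~ initial_mul d z].

End Depth.

Definition depth M (d : nat) : Prop :=
  (exists x : 'I_d -> Rf lambda, regular_sequence M x) /\
  (forall e (x : 'I_e -> Rf lambda), regular_sequence M x -> (e <= d)%N).

(* The zero module has no depth here, hence is not MCM. *)
Definition MCM M : Prop :=
  finitely_generated M /\ exists d, krull_dim (Rf lambda) d /\ depth M d.

Definition kscale M (c : k) (z : M) : M := toR lambda c%:MP *: z.

Definition kdim M (V : {pred M}) (d : nat) : Prop :=
  exists b : 'I_d -> M,
  [/\ forall i, b i \in V,
      forall c : 'I_d -> k, \sum_i kscale (c i) (b i) = 0 -> forall i, c i = 0
    & forall z, z \in V -> exists c : 'I_d -> k, z = \sum_i kscale (c i) (b i)].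

Definition hilbert_function M (h : int -> nat) : Prop :=
  forall n, kdim (gpart M n) (h n).

(* The coefficient of t^n in the Laurent expansion of t^s p(t) / (1 - t). *)
Definition laurent_coef (s : int) (p : {poly int}) (n : int) : int :=
  if (s <= n)%R then \sum_(j < `|n - s|%N.+1) p`_j else 0.

(* The Laurent polynomial P_M is written t^s p(t), so that P_M(1) = p(1). *)
Definition multiplicity M (e : int) : Prop :=
  exists (h : int -> nat) (s : int) (p : {poly int}),
  [/\ hilbert_function M h,
      forall n, (h n)%:Z = laurent_coef s p n,
      p.[1] != 0
    & e = p.[1]].

Definition ulrich M : Prop :=
  MCM M /\ exists m : nat, min_number_generators M m /\ multiplicity M m%:Z.

Definition graded_submodule M (N : {pred M}) : Prop :=
  submod_closed N /\
  forall z, z \in N -> exists (s : seq int) (z_ : int -> M),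
    (forall n, z_ n \in gpart M n /\ z_ n \in N) /\ z = \sum_(n <- s) z_ n.

(* Indecomposability in the category of graded modules, hence M <> 0. *)
Definition indecomposable M : Prop :=
  (exists z : M, z <> 0) /\
  forall N1 N2 : {pred M}, graded_submodule N1 -> graded_submodule N2 ->
    (forall z, exists z1 z2, [/\ z1 \in N1, z2 \in N2 & z = z1 + z2]) ->
    (forall z, z \in N1 -> z \in N2 -> z = 0) ->
    (forall z, z \in N1 -> z = 0) \/ (forall z, z \in N2 -> z = 0).

End GradedModules.

Section L.
Variables (k : closedFieldType) (lambda : k) (i : 'I_4).
Local Notation l := (pl lambda i).
Local Notation L := (cyclic_module (toR lambda l)).
Local Notation proj := (cyclic_proj (toR lambda l)).

Definition Lpart (n : int) : {pred L} :=
  match n with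
  | Posz d => fun z => `[< exists2 r, r \in Rpart lambda d & z = proj r >]
  | Negz _ => pred1 0
  end.

Lemma pl_homog : l \is 1.-homog.
Proof.
have hX : pX k \is 1.-homog by rewrite dhomogX; apply/eqP; exact: mdeg1.
have hY : pY k \is 1.-homog by rewrite dhomogX; apply/eqP; exact: mdeg1.
by case: i => -[|[|[|[|//]]]] ? /=; rewrite /pl /tnth /= ?rpredB ?rpredZ.
Qed.

Lemma pl_dvd_pf : exists q, pf lambda = q * l.
Proof.
rewrite /pf; case: i => -[|[|[|[|//]]]] ? /=; rewrite /pl /tnth /=.
- by exists (pY k * (pX k - pY k) * (pX k - lambda *: pY k));
     rewrite [RHS]mulrC !mulrA.
- exists (pX k * (pX k - pY k) * (pX k - lambda *: pY k)).
  by rewrite [RHS]mulrC !mulrA (mulrC (pY k)).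
- exists (pX k * pY k * (pX k - lambda *: pY k)).
  by rewrite [RHS]mulrAC.
- by exists (pX k * pY k * (pX k - pY k)).
Qed.

Lemma proj_toR_eq0 p : proj (toR lambda p) = 0 <-> exists q, p = q * l.
Proof.
rewrite -cyclic_proj0 cyclic_proj_eq subr0; split=> [/principalP[b]|[q ->]].
  have [c ->] := toR_surj b; rewrite -rmorphM => /eqP.
  rewrite -subr_eq0 -rmorphB => /eqP/toR_eq0[u /eqP]; rewrite subr_eq => /eqP ->.
  by have [v ->] := pl_dvd_pf; exists (u * v + c); rewrite mulrDl mulrA.
by apply/principalP; exists (toR lambda q); rewrite rmorphM.
Qed.

Lemma RpartP d r :
  reflect (exists2 p, p \is d.-homog & r = toR lambda p) (r \in Rpart lambda d).
Proof. exact: asboolP. Qed.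

Lemma LpartP (d : nat) (z : L) :
  reflect (exists2 p, p \is d.-homog & z = proj (toR lambda p)) (z \in Lpart d).
Proof.
apply: (iffP (asboolP _)) => [[r /RpartP[p hp ->] ->]|[p hp ->]]; first by exists p.
by exists (toR lambda p) => //; apply/RpartP; exists p.
Qed.

Lemma Lpart_zmod_closed n : zmod_closed (Lpart n).
Proof.
case: n => [d|d]; split.
- by apply/LpartP; exists 0; rewrite ?rpred0 // rmorph0 cyclic_proj0.
- move=> x y /LpartP[p hp ->] /LpartP[q hq ->]; apply/LpartP.
  by exists (p - q); rewrite ?rpredB // rmorphB cyclic_projB.
- exact: eqxx.
- by move=> x y /eqP -> /eqP ->; rewrite subr0; apply: eqxx.
Qed.

Lemma Lpart_scale (d : nat) (n : int) a z :
  a \in Rpart lambda d -> z \in Lpart n -> a *: z \in Lpart (d%:Z + n).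
Proof.
move=> /RpartP[p hp ->]; case: n => [e /LpartP[q hq ->]|e /eqP ->].
  apply/LpartP; exists (p * q); first exact: dhomogM.
  by rewrite rmorphM; apply: cyclic_scaleE.
by rewrite scaler0 (Lpart_zmod_closed _).1.
Qed.

Lemma Lpart_span z : exists (s : seq int) (z_ : int -> L),
  (forall n, z_ n \in Lpart n) /\ z = \sum_(n <- s) z_ n.
Proof.
have [r ->] := cyclic_proj_surj z; have [p ->] := toR_surj r.
exists [seq Posz d | d <- index_iota 0 (msize p)].
exists (fun n => if n is Posz d then proj (toR lambda (pihomog mdeg d p)) else 0).
split=> [[d|d]|]; [|exact: (Lpart_zmod_closed _).1|].
  by apply/LpartP; exists (pihomog mdeg d p) => //; apply: pihomogP.
rewrite big_map big_mkord.
rewrite {1}(pihomog_partitionE (mf := mdeg) (k := msize p) (p := p)).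
  rewrite rmorph_sum; elim/big_rec2: _ => [|j x y _ <-]; first exact: cyclic_proj0.
  by rewrite cyclic_projD.
by [].
Qed.

Lemma Lpart_direct (s : seq int) (z_ : int -> L) : uniq s ->
  (forall n, z_ n \in Lpart n) -> \sum_(n <- s) z_ n = 0 ->
  forall n, n \in s -> z_ n = 0.
Proof.
move=> us zP sum0.
have /boolp.choice[p_ pP] : forall n : int, exists p : {mpoly k[2]},
    (if n is Posz d then is_true (p \is d.-homog) else p = 0) /\
    z_ n = proj (toR lambda p).
  move=> [d|d]; last first.
    exists 0; split=> //; rewrite rmorph0 cyclic_proj0.
    by apply/eqP; exact: (zP (Negz d)).
  by have /LpartP[p hp hz] := zP (Posz d); exists p.
have [q qE] : exists q, \sum_(n <- s) p_ n = q * l.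
  apply/proj_toR_eq0; rewrite -sum0 rmorph_sum.
  elim/big_rec2: _ => [|n x y _ <-]; first exact: cyclic_proj0.
  by rewrite cyclic_projD (pP n).2.
case=> [d|d] dS; last by rewrite (pP _).2 (pP (Negz d)).1 rmorph0 cyclic_proj0.
rewrite (pP _).2; apply/proj_toR_eq0.
have -> : p_ d = pihomog mdeg d (\sum_(n <- s) p_ n).
  rewrite (bigD1_seq (Posz d)) //= raddfD /= pihomog_dE ?(pP (Posz d)).1 //.
  rewrite raddf_sum /= big1 ?addr0 // => -[e|e] ne; last first.
    by rewrite (pP (Negz e)).1 raddf0.
  by apply: (@pihomog_ne0 _ _ _ e); [move: ne; rewrite eqz_nat | exact: (pP (Posz e)).1].
rewrite qE (pihomog_partitionE (mf := mdeg) (leqnn (mmeasure mdeg q))).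
rewrite mulr_suml raddf_sum /=.
elim/big_rec: _ => [|e x _ [u ->]]; first by exists 0; rewrite mul0r.
have hom : pihomog mdeg e q * l \is (e + 1).-homog.
  by apply: dhomogM; [exact: pihomogP | exact: pl_homog].
have [eqd|ned] := eqVneq (e + 1)%N d.
  rewrite pihomog_dE -?eqd //.
  by exists (pihomog mdeg e q + u); rewrite mulrDl.
by rewrite (@pihomog_ne0 _ _ _ (e + 1)%N) // add0r; exists u.
Qed.

Definition L_ : gradedModule lambda :=
  GradedModule Lpart_zmod_closed Lpart_scale Lpart_span Lpart_direct.

End L.

Arguments L_ {k} lambda i.

(* Main.v *)
From HB Require Import structures.
Require Import Defs.
From mathcomp Require Import all_boot all_order all_algebra.
From mathcomp Require Import generic_quotient ring_quotient mpoly boolp.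
From mathcomp Require Import ring zify.

Set Implicit Arguments.
Unset Strict Implicit.
Unset Printing Implicit Defensive.

Import Order.TTheory GRing.Theory.
Local Open Scope ring_scope.

(* Choose q with q (q - 1) (q - lambda) = 1 and put x = X - q Y.  Since M has positive
   depth, no nonzero vector is killed by both X and Y; if x z = 0 then 0 = f z = Y^4 z,
   so x is M-regular.  Counting generators degree by degree, mu(M) = e(M) = dim M/xM
   forces Y M to lie in x M: M has minimal multiplicity with respect to x.  Two coprime
   forms g and l with g l M = 0 satisfy x^d = a g + r l, and as g z is divisible by x^d,
   dividing by x^d splits every z into a part killed by l and a part killed by g.
   Indecomposability, applied to the factors of f, leaves one l_i with l_i M = 0.  Then
   M is graded torsion-free over R/(l_i) = k[x].  A generator v of lowest degree spans a
   direct summand, a complement being the x-saturation of a hyperplane of M_N for large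
   N; hence M = R v, with annihilator (l_i). *)

(** * Linear forms in R and the choice of the generic slope *)

Section LinearForms.
Variables (k : closedFieldType) (lambda : k).

Local Notation cst c := (toR lambda c%:MP).

Definition linform (a b : k) : Rf lambda :=
  cst a * toR lambda (pX k) + cst b * toR lambda (pY k).

Lemma toR_linE a b : linform a b = toR lambda (a *: pX k + b *: pY k).
Proof. by rewrite /linform -!mul_mpolyC rmorphD !rmorphM. Qed.

Lemma lin_Rpart a b : linform a b \in Rpart lambda 1.
Proof.
apply/RpartP; exists (a *: pX k + b *: pY k); last exact: toR_linE.
by rewrite rpredD // rpredZ // dhomogX; apply/eqP; exact: mdeg1.
Qed.

Lemma cst_Rpart c : cst c \in Rpart lambda 0.
Proof.
apply/RpartP; exists c%:MP => //.
by rewrite -[c%:MP]mulr1 mul_mpolyC rpredZ // dhomog1.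
Qed.

Lemma cstD a b : cst (a + b) = cst a + cst b.
Proof. by rewrite mpolyCD rmorphD. Qed.
Lemma cstM a b : cst (a * b) = cst a * cst b.
Proof. by rewrite mpolyCM rmorphM. Qed.
Lemma cstN a : cst (- a) = - cst a.
Proof. by rewrite mpolyCN rmorphN. Qed.
Lemma cst0 : cst 0 = 0. Proof. by rewrite mpolyC0 rmorph0. Qed.
Lemma cst1 : cst 1 = 1. Proof. by rewrite mpolyC1 rmorph1. Qed.

Lemma linX : toR lambda (pX k) = linform 1 0.
Proof. by rewrite /linform cst0 cst1; ring. Qed.
Lemma linY : toR lambda (pY k) = linform 0 1.
Proof. by rewrite /linform cst0 cst1; ring. Qed.

Lemma linD a b a' b' : linform (a + a') (b + b') = linform a b + linform a' b'.
Proof. by rewrite /linform !cstD; ring. Qed.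
Lemma linZ c a b : linform (c * a) (c * b) = cst c * linform a b.
Proof. by rewrite /linform !cstM; ring. Qed.

(** Cramer's rule. *)
Lemma lin_span a1 b1 a2 b2 a b : a1 * b2 - a2 * b1 != 0 ->
  exists s t, linform a b = cst s * linform a1 b1 + cst t * linform a2 b2.
Proof.
move=> D0; set D := _ - _ in D0.
exists ((a * b2 - a2 * b) / D), ((a1 * b - a * b1) / D).
by rewrite -!linZ -linD; congr linform; rewrite /D; field; rewrite -/D.
Qed.

Definition form_coeffs (i : 'I_4) : k * k :=
  tnth [tuple (1, 0); (0, 1); (1, - 1); (1, - lambda)] i.

Lemma toR_pl i : toR lambda (pl lambda i) =
  linform (form_coeffs i).1 (form_coeffs i).2.
Proof.
rewrite /pl /form_coeffs; case: i => -[|[|[|[|//]]]] ? /=; rewrite /tnth /=.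
- exact: linX.
- exact: linY.
- by rewrite toR_linE scale1r scaleNr scale1r.
- by rewrite toR_linE scale1r scaleNr.
Qed.

Lemma toR_pf : \prod_(i < 4) toR lambda (pl lambda i) = 0.
Proof.
rewrite !big_ord_recr big_ord0 /= mul1r -!rmorphM /=.
apply/toR_eq0; exists 1; rewrite mul1r /pf /pl /tnth /=; congr (_ * _ * _ * _).
Qed.

Definition coeff_det (u v : k * k) : k := u.1 * v.2 - v.1 * u.2.

(** The four lines are pairwise distinct: up to sign the determinants are 1, lambda and 1 -
    lambda. *)
Lemma form_coeffs_det i j : lambda != 0 -> lambda != 1 -> i != j ->
  coeff_det (form_coeffs i) (form_coeffs j) != 0.
Proof.
move=> l0 l1; have l1' : 1 - lambda != 0 by rewrite subr_eq0 eq_sym.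
have l1'' : lambda - 1 != 0 by rewrite subr_eq0.
rewrite /form_coeffs /coeff_det.
case: i j => -[|[|[|[|//]]]] ? -[[|[|[|[|//]]]] ?] //=; rewrite /tnth /= => _;
 rewrite ?(mulr0, mul0r, mulr1, mul1r, subr0, sub0r, oppr_eq0, oner_eq0, addrN, opprK) //;
 by rewrite addrC.
Qed.

(* With the value 1, X z = c Y z implies f z = Y^4 z. *)
Lemma exists_generic_slope : exists c, c * (c - 1) * (c - lambda) = 1.
Proof.
pose P : {poly k} := 'X * ('X - 1%:P) * ('X - lambda%:P) - 1.
have [|c] := closed_rootP P _; last first.
  rewrite /root /P !hornerE => /eqP/eqP; rewrite subr_eq0 => /eqP h.
  by exists c.
have -> : P = 'X * ('X - 1%:P) * ('X - lambda%:P) + (-1)%:P by rewrite polyCN.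
have s4 : size ('X * ('X - 1%:P) * ('X - lambda%:P) : {poly k}) = 4.
  rewrite -{1}[ 'X ]subr0 -polyC0.
  have := size_prod_XsubC [:: 0; 1; lambda] id.
  by rewrite !big_cons big_nil mulr1 mulrA.
rewrite size_polyDl s4 // size_polyC; by case: (_ != 0).
Qed.

End LinearForms.

(** * Graded pieces and degreewise direct sum decompositions *)

Section GradedModuleTheory.
Variables (k : closedFieldType) (lambda : k) (M : gradedModule lambda).

Local Notation cst c := (toR lambda c%:MP).
Local Notation lin := (linform lambda).

Lemma gpart0 n : (0 : M) \in gpart M n.
Proof. by have [] := gpart_zmod_closed M n. Qed.
Lemma gpartB n : {in gpart M n &, forall u v, u - v \in gpart M n}.
Proof. by have [] := gpart_zmod_closed M n. Qed.
Lemma gpartD n : {in gpart M n &, forall u v, u + v \in gpart M n}.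
Proof.
move=> u v hu hv; rewrite -[v]opprK; apply: gpartB => //.
by rewrite -sub0r gpartB ?gpart0.
Qed.

Lemma gpart_cst n c z : z \in gpart M n -> cst c *: z \in gpart M n.
Proof. by move=> hz; rewrite -[n]add0r; apply: gpart_scale => //; exact: cst_Rpart. Qed.

Lemma gpart_lin n a b z : z \in gpart M n -> lin a b *: z \in gpart M (n + 1).
Proof. by move=> hz; rewrite addrC; apply: gpart_scale => //; exact: lin_Rpart. Qed.

Lemma gpart_linX n a b d z : z \in gpart M n -> lin a b ^+ d *: z \in gpart M (n + d%:Z).
Proof.
move=> hz; elim: d => [|d IH]; first by rewrite expr0 scale1r addr0.
rewrite exprS -scalerA (_ : n + d.+1%:Z = n + d%:Z + 1) ?gpart_lin //; lia.
Qed.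

Lemma gpart_sum n (I : Type) (r : seq I) (P : pred I) (F : I -> M) :
  (forall i, P i -> F i \in gpart M n) -> \sum_(i <- r | P i) F i \in gpart M n.
Proof.
move=> hF; elim/big_rec: _ => [|i z hi hz]; first exact: gpart0.
by apply: gpartD => //; apply: hF.
Qed.

Lemma gscaler_sumr r (I : Type) (s : seq I) (P : pred I) (F : I -> M) :
  r *: (\sum_(i <- s | P i) F i) = \sum_(i <- s | P i) r *: F i.
Proof. exact: scaler_sumr. Qed.

Lemma gscalerC r r' (z : M) : r *: (r' *: z) = r' *: (r *: z).
Proof. by rewrite !scalerA mulrC. Qed.

(** R is generated by constants and linear forms, so stability under R follows by induction on a
    polynomial representing r. *)
Lemma scale_closed (N : M -> Prop) :
  N 0 -> (forall u v, N u -> N v -> N (u + v)) ->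
  (forall c z, N z -> N (cst c *: z)) ->
  (forall a b z, N z -> N (lin a b *: z)) ->
  forall r z, N z -> N (r *: z).
Proof.
move=> N0 ND NC NL r z Nz; have [p ->] := toR_surj r.
elim/mpolyind: p => [|c m p _ _ IH]; first by rewrite rmorph0 scale0r.
rewrite rmorphD scalerDl; apply: ND => //.
rewrite -mul_mpolyC rmorphM -scalerA; apply: NC.
rewrite mpolyXE_id rmorph_prod.
rewrite !big_ord_recr big_ord0 /= mul1r -scalerA.
have NX a b d w : N w -> N (lin a b ^+ d *: w).
  by move=> Nw; elim: d => [|d IHd]; rewrite ?expr0 ?scale1r // exprS -scalerA; exact: NL.
rewrite !rmorphXn /=.
have -> : widen_ord (leqnSn 1) ord_max = ord0 :> 'I_2 by apply: val_inj.
by rewrite -/(pX k) -/(pY k) linX linY; apply/NX/NX.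
Qed.

(** The degree list from [gpart_span] may repeat degrees, while [gpart_direct] wants a
    duplicate-free one; repetitions become integer multiplicities over a common list S. *)
Lemma sum_count (s S : seq int) (z_ : int -> M) : uniq S -> {subset s <= S} ->
  \sum_(n <- s) z_ n = \sum_(n <- S) z_ n *+ count_mem n s.
Proof.
move=> uS sS; elim: s sS => [|m s IH] sS.
  by rewrite big_nil big1 // => n _; rewrite mulr0n.
rewrite big_cons IH; last by move=> n hn; apply: sS; rewrite inE hn orbT.
have mS : m \in S by apply: sS; rewrite mem_head.
under [RHS]eq_bigr do rewrite /= mulrnDr.
rewrite big_split /=; congr (_ + _).
rewrite (bigD1_seq m) //= eqxx mulr1n big1 ?addr0 // => n nm.
by rewrite eq_sym (negPf nm) mulr0n.
Qed.

Section HomogeneousSplitting.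

Definition homog_sum (Q : int -> M -> Prop) : {pred M} := fun z =>
  `[< exists (s : seq int) (z_ : int -> M),
        (forall n, Q n (z_ n)) /\ z = \sum_(n <- s) z_ n >].

(** [Q n] plays the degree n component of a graded submodule; by [scale_closed], closure under
    constants and linear forms is enough. *)
Definition homog_submodule (Q : int -> M -> Prop) : Prop :=
  [/\ forall n z, Q n z -> z \in gpart M n, forall n, Q n 0,
      forall n u v, Q n u -> Q n v -> Q n (u + v),
      forall n c z, Q n z -> Q n (cst c *: z) &
      forall n a b z, Q n z -> Q (n + 1) (lin a b *: z)].

Lemma homog_sumMn Q n z m : homog_submodule Q -> Q n z -> Q n (z *+ m).
Proof.
by case=> _ Q0 QD _ _ Qz; elim: m => [|m IH]; rewrite ?mulr0n // mulrS; exact: QD.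
Qed.

Lemma mem_homog_sum Q n z : homog_submodule Q -> Q n z -> z \in homog_sum Q.
Proof.
case=> _ Q0 _ _ _ Qz; apply/asboolP.
exists [:: n], (fun m => if m == n then z else 0).
by split=> [m|]; [case: eqVneq => [->|] | rewrite big_seq1 eqxx].
Qed.

Lemma homog_sum_graded Q : homog_submodule Q -> graded_submodule (homog_sum Q).
Proof.
move=> hQ; have [QM Q0 QD QC QL] := hQ.
have N1 n z := @mem_homog_sum Q n z hQ.
have N0 : 0 \in homog_sum Q by exact: N1 (Q0 0).
have ND u v : u \in homog_sum Q -> v \in homog_sum Q -> u + v \in homog_sum Q.
  case/asboolP=> s [u_ [hu ->]] /asboolP[t [v_ [hv ->]]]; apply/asboolP.
  pose S := undup (s ++ t).
  exists S, (fun n => u_ n *+ count_mem n s + v_ n *+ count_mem n t).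
  split=> [n|]; first by apply: QD; apply: homog_sumMn.
  rewrite big_split /= (@sum_count s S) ?(@sum_count t S) ?undup_uniq //;
    by move=> n hn; rewrite mem_undup mem_cat hn ?orbT.
have Nsum (s : seq int) (F : int -> M) :
  (forall n, F n \in homog_sum Q) -> \sum_(n <- s) F n \in homog_sum Q.
  by move=> hF; elim/big_rec: _ => [//|i x _ hx]; exact: ND.
split; last first.
  move=> z /asboolP[s [z_ [hz ->]]]; exists s, z_; split=> // n; split; first exact: QM.
  exact: N1 (hz n).
split=> [//|r u v hu hv]; apply: (ND) => //; move: u hu {v hv}.
apply: (scale_closed (N := fun z => z \in homog_sum Q)) => //.
- move=> c z /asboolP[s [z_ [hz ->]]]. rewrite gscaler_sumr; apply: Nsum => n.
  by apply: (N1 n); exact: QC.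
- move=> a b z /asboolP[s [z_ [hz ->]]]; rewrite gscaler_sumr; apply: Nsum => n.
  by apply: (N1 (n + 1)); exact: QL.
Qed.

Lemma homog_indecomposable (Q1 Q2 : int -> M -> Prop) :
  indecomposable M -> homog_submodule Q1 -> homog_submodule Q2 ->
  (forall n z, z \in gpart M n -> exists z1 z2, [/\ Q1 n z1, Q2 n z2 & z = z1 + z2]) ->
  (forall n z, Q1 n z -> Q2 n z -> z = 0) ->
  (forall n z, Q1 n z -> z = 0) \/ (forall n z, Q2 n z -> z = 0).
Proof.
move=> [_ indec] hQ1 hQ2 cover disj.
have [|||] := indec _ _ (homog_sum_graded hQ1) (homog_sum_graded hQ2).
- move=> z; have [s [z_ [hz ->]]] := gpart_span z.
  have /choice[u hu] n : exists z1, exists z2, [/\ Q1 n z1, Q2 n z2 & z_ n = z1 + z2].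
    exact: cover.
  have /choice[w hw] n := hu n.
  exists (\sum_(n <- s) u n), (\sum_(n <- s) w n); split.
  + by apply/asboolP; exists s, u; split=> // n; case: (hw n).
  + by apply/asboolP; exists s, w; split=> // n; case: (hw n).
  + by rewrite -big_split; apply: eq_bigr => n _; case: (hw n).
- move=> z /asboolP[s [u [hu zE]]] /asboolP[t [w [hw zE']]].
  pose S := undup (s ++ t).
  have sS : {subset s <= S} by move=> n hn; rewrite mem_undup mem_cat hn.
  have tS : {subset t <= S} by move=> n hn; rewrite mem_undup mem_cat hn orbT.
  rewrite (sum_count _ _ sS) ?undup_uniq // in zE.
  rewrite (sum_count _ _ tS) ?undup_uniq // in zE'.
  have Q1u n : Q1 n (u n *+ count_mem n s) by exact: homog_sumMn.
  have Q2w n : Q2 n (w n *+ count_mem n t) by exact: homog_sumMn.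
  rewrite zE big1_seq // => n /andP[_ nS]; apply: (disj n) => //.
  (* Directness of the grading, applied to the differences of the two expansions of z, identifies
     them degree by degree. *)
  suff -> : u n *+ count_mem n s = w n *+ count_mem n t by [].
  apply/eqP; rewrite -subr_eq0; apply/eqP; move: n nS.
  apply: gpart_direct; first exact: undup_uniq.
    move=> n; case: hQ1 hQ2 => Q1M _ _ _ _ [Q2M _ _ _ _].
    by apply: gpartB; [exact: Q1M | exact: Q2M].
  by rewrite sumrB -zE -zE' subrr.
- by move=> H; left=> n z Qz; apply: H; exact: mem_homog_sum Qz.
- by move=> H; right=> n z Qz; apply: H; exact: mem_homog_sum Qz.
Qed.

End HomogeneousSplitting.
End GradedModuleTheory.

(** * Positivity of the Krull dimension of R *)

Section KrullDimension.
Variables (k : closedFieldType) (lambda : k).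

Definition ker_ideal (S : idomainType) (phi : {mpoly k[2]} -> S) : {pred Rf lambda} :=
  fun r => `[< exists2 p, r = toR lambda p & phi p = 0 >].

Lemma ker_idealE (S : idomainType) (phi : {rmorphism {mpoly k[2]} -> S}) p :
  phi (pf lambda) = 0 -> (toR lambda p \in ker_ideal phi) = (phi p == 0).
Proof.
move=> phi_f; apply/asboolP/eqP => [[q /eqP]|]; last by exists p.
rewrite -subr_eq0 -rmorphB => /eqP/toR_eq0[u /(congr1 phi)].
by rewrite rmorphM /= phi_f mulr0 rmorphB => /eqP; rewrite subr_eq0 => /eqP ->.
Qed.

(** A map to a domain that kills f factors through R, and the kernel of the induced map is prime. *)
Lemma ker_ideal_prime (S : idomainType) (phi : {rmorphism {mpoly k[2]} -> S}) :
  phi (pf lambda) = 0 ->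
  idealr_closed (ker_ideal phi) /\ prime_idealr_closed (ker_ideal phi).
Proof.
move=> phi_f; have E p := ker_idealE p phi_f; split; first split.
- by rewrite -(rmorph0 (toR lambda)) E rmorph0.
- by rewrite -(rmorph1 (toR lambda)) E rmorph1 oner_eq0.
- move=> a u v; have [p ->] := toR_surj a.
  have [q ->] := toR_surj u; have [r ->] := toR_surj v.
  rewrite -rmorphM -rmorphD !E => /eqP hq /eqP hr.
  by rewrite rmorphD rmorphM /= hq hr mulr0 addr0.
- move=> u v; have [q ->] := toR_surj u; have [r ->] := toR_surj v.
  by rewrite -rmorphM !E rmorphM mulf_eq0.
Qed.

(* Restriction to the line X = 0. *)
Definition on_Yaxis (p : {mpoly k[2]}) : {poly k} :=
  mmap (@polyC k) (fun i : 'I_2 => if i == ord0 then 0 else 'X) p.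
HB.instance Definition _ := GRing.RMorphism.copy on_Yaxis
  (mmap (@polyC k) (fun i : 'I_2 => if i == ord0 then 0 else 'X)).

(** The chain consists of the functions vanishing on the line X = 0 and those vanishing at the
    origin; Y separates them. *)
Lemma krull_dim_gt0 d : krull_dim (Rf lambda) d -> (0 < d)%N.
Proof.
case=> _ dim_le.
pose P0 := ker_ideal on_Yaxis.
pose P1 := ker_ideal (horner_eval (0 : k) \o on_Yaxis).
have X0 : on_Yaxis (pX k) = 0 by rewrite /on_Yaxis /pX mmapX mmap1U eqxx.
have YX : on_Yaxis (pY k) = 'X by rewrite /on_Yaxis /pY mmapX mmap1U.
have f0 : on_Yaxis (pf lambda) = 0 by rewrite /pf !rmorphM /= X0 !mul0r.
have f1 : (horner_eval (0 : k) \o on_Yaxis) (pf lambda) = 0.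
  by rewrite /= f0 /horner_eval horner0.
apply: (dim_le 1%N (fun i : 'I_2 => if i == ord0 then P0 else P1)); split.
  move=> i; case: ifP => _; exact: ker_ideal_prime.
move=> i j lt_ij; have [-> ->] : i = ord0 /\ j = ord_max.
  by split; apply: val_inj; move: i j lt_ij => [[|[|i]] ?] [[|[|j]] ?].
rewrite /=; split.
  move=> r; have [p ->] := toR_surj r.
  by rewrite !ker_idealE //= => /eqP ->; rewrite /horner_eval horner0.
by exists (toR lambda (pY k)); rewrite ker_idealE //= YX ?polyX_eq0 // /horner_eval hornerX.
Qed.
End KrullDimension.

(** * Regularity of the generic linear form *)

Section Regularity.
Variables (k : closedFieldType) (lambda : k) (M : gradedModule lambda).
Hypothesis M_MCM : MCM M.

Local Notation cst c := (toR lambda c%:MP).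
Local Notation lin := (linform lambda).

(** The depth equals the dimension, hence is positive, and the first element of a regular sequence
    lies in (X, Y): it kills z but is injective on M. *)
Lemma MCM_socle0 (z : M) :
  toR lambda (pX k) *: z = 0 -> toR lambda (pY k) *: z = 0 -> z = 0.
Proof.
move=> Xz Yz; have [_ [d [/krull_dim_gt0 d_gt0 [[x [xm xreg _]] _]]]] := M_MCM.
have /asboolP[a [b x0E]] := xm (Ordinal d_gt0).
have im0 w : initial_mul x 0 w -> w = 0 by case=> u ->; rewrite big_pred0.
apply: im0; apply: (xreg (Ordinal d_gt0)); exists (fun=> 0).
by rewrite big_pred0 // x0E scalerDl -!scalerA Xz Yz !scaler0 addr0.
Qed.

Lemma generic_lin_regular (c : k) (z : M) : c * (c - 1) * (c - lambda) = 1 ->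
  lin 1 (- c) *: z = 0 -> z = 0.
Proof.
move=> hc xz.
have X_cY (w : M) : lin 1 (- c) *: w = 0 ->
    toR lambda (pX k) *: w = cst c *: (toR lambda (pY k) *: w).
  move=> /eqP; rewrite /linform cst1 mul1r cstN mulNr scalerBl subr_eq0 scalerA => /eqP.
  exact.
have Ystep (w : M) : lin 1 (- c) *: w = 0 -> toR lambda (pY k) *: w = 0 -> w = 0.
  by move=> xw Yw; apply: MCM_socle0 => //; rewrite X_cY // Yw scaler0.
have xY j : lin 1 (- c) *: (toR lambda (pY k) ^+ j *: z) = 0.
  by rewrite scalerA mulrC -scalerA xz scaler0.
have Y4 : toR lambda (pY k) ^+ 4 *: z = 0.
  pose q := lin 1 (- c); pose y := toR lambda (pY k).
  have xE : toR lambda (pX k) = q + cst c * y by rewrite /q /linform cst1 cstN; ring.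
  have F0 : toR lambda (pf lambda) = 0 by apply/toR_eq0; exists 1; rewrite mul1r.
  move: F0; rewrite /pf -mul_mpolyC !(rmorphM, rmorphB) /= -/y xE => F0.
  suff [r rE] : exists r, y ^+ 4 = r * q.
    by rewrite rE -scalerA xz scaler0.
  have hc' : cst c * (cst c - 1) * (cst c - cst lambda) = 1.
    by rewrite -cst1 -!cstN -!cstD -!cstM hc cst1.
  (* Modulo [q] the factors X, X - Y and X - lambda Y of f become A, B and C, and y A B C = y^4 by
     the choice of c. The witness collects the terms of f = 0 divisible by [q]. *)
  pose A := cst c * y; pose B := (cst c - 1) * y; pose C := (cst c - cst lambda) * y.
  exists (- (y * (q ^+ 2 + (A + B + C) * q + (A * B + B * C + C * A)))).
  have -> : y ^+ 4 = (cst c * (cst c - 1) * (cst c - cst lambda)) * y ^+ 4.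
    by rewrite hc' mul1r.
  apply/eqP; rewrite -subr_eq0; apply/eqP; rewrite -[RHS]F0 /A /B /C; ring.
(* Y is injective on the kernel of x, so its powers can be removed one at a time. *)
have descend j : toR lambda (pY k) ^+ j *: z = 0 -> z = 0.
  elim: j => [|j IH]; first by rewrite expr0 scale1r.
  by rewrite exprS -scalerA => /(Ystep _ (xY j)).
exact: descend Y4.
Qed.
End Regularity.

(** * Linear algebra over k in a graded piece *)

Section LinearAlgebra.
Variables (k : closedFieldType) (lambda : k) (M : gradedModule lambda).

Local Notation cst c := (toR lambda c%:MP).

Definition kcomb d (b : 'I_d -> M) (c : 'rV[k]_d) : M := \sum_i kscale (c 0 i) (b i).

Definition kindep d (b : 'I_d -> M) : Prop :=
  forall c : 'I_d -> k, \sum_i kscale (c i) (b i) = 0 -> forall i, c i = 0.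

Lemma kcombD d (b : 'I_d -> M) c c' : kcomb b (c + c') = kcomb b c + kcomb b c'.
Proof.
rewrite /kcomb -big_split; apply: eq_bigr => i _.
by rewrite mxE /kscale cstD scalerDl.
Qed.

Lemma kcombZ d (b : 'I_d -> M) a c : kcomb b (a *: c) = cst a *: kcomb b c.
Proof.
rewrite gscaler_sumr; apply: eq_bigr => i _.
by rewrite mxE /kscale cstM scalerA.
Qed.

Lemma kcomb0 d (b : 'I_d -> M) : kcomb b 0 = 0.
Proof. by apply: big1 => i _; rewrite mxE /kscale cst0 scale0r. Qed.

Lemma kcombB d (b : 'I_d -> M) c c' : kcomb b (c - c') = kcomb b c - kcomb b c'.
Proof. by rewrite -[- c']scaleN1r kcombD kcombZ cstN cst1 scaleN1r. Qed.

Lemma kcomb_sum d (b : 'I_d -> M) (I : finType) (F : I -> 'rV_d) :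
  kcomb b (\sum_i F i) = \sum_i kcomb b (F i).
Proof. by apply: (big_morph (kcomb b)); [exact: kcombD | exact: kcomb0]. Qed.

Lemma kcomb_mulmx d e (b : 'I_d -> M) (c : 'rV_e) (A : 'M_(e, d)) :
  kcomb b (c *m A) = kcomb (fun i => kcomb b (row i A)) c.
Proof.
rewrite mulmx_sum_row kcomb_sum; apply: eq_bigr => i _.
exact: kcombZ.
Qed.

Lemma kcomb_ker d (b : 'I_d -> M) c : kindep b -> kcomb b c = 0 -> c = 0.
Proof. by move=> ib /ib c0; apply/rowP => i; rewrite mxE c0. Qed.

(** Steinitz completion through matrices: in coordinates the vectors u are the rows of U, and w
    comes from a basis of a complement of its row space. *)
Lemma kdim_extend (V : {pred M}) d a (u : 'I_a -> M) :
  kdim V d -> (forall i, u i \in V) -> kindep u ->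
  exists r (w : 'I_r -> M), (a + r = d)%N /\
    forall z, z \in V -> exists c c', z = kcomb u c + kcomb w c'.
Proof.
case=> b [bV b_indep b_span] uV u_indep.
have bspan z : z \in V -> exists c : 'rV_d, z = kcomb b c.
  move=> /b_span[c ->]; exists (\row_i c i).
  by apply: eq_bigr => i _; rewrite mxE.
have /choice[c cE] i : exists c : 'rV_d, u i = kcomb b c by apply: bspan.
pose U : 'M_(a, d) := \matrix_i c i.
have uE e : kcomb u e = kcomb b (e *m U).
  rewrite kcomb_mulmx; apply: eq_bigr => i _.
  by rewrite rowK -cE.
have U_free : row_free U.
  rewrite -kermx_eq0; apply/eqP/row_matrixP => i.
  rewrite row0; apply: (kcomb_ker u_indep); rewrite uE -row_mul mulmx_ker row0.
  exact: kcomb0.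
pose W := row_base (U^C)%MS.
exists (\rank (U^C)%MS), (fun i => kcomb b (row i W)); split.
  by rewrite mxrank_compl (eqP U_free) subnKC // -(eqP U_free) rank_leq_col.
move=> z /bspan[e ->].
have : (e <= U + W)%MS.
  rewrite (adds_eqmx (eqmx_refl U) (eq_row_base _)).
  by rewrite (submx_trans (submx1 _)) // sub1mx addsmx_compl_full.
case/sub_addsmxP=> -[c1 c2] /= ->; exists c1, c2.
by rewrite kcombD -uE kcomb_mulmx.
Qed.

Definition fcons d (z : M) (u : 'I_d -> M) (i : 'I_d.+1) : M :=
  if unlift ord0 i is Some j then u j else z.

Lemma kindep_cons d (z : M) (u : 'I_d -> M) :
  kindep u -> (forall c, z <> kcomb u c) -> kindep (fcons z u).
Proof.
move=> u_indep z_out c; rewrite big_ord_recl /fcons unlift_none.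
under eq_bigr do rewrite liftK; move=> sum0.
have c0 : c ord0 = 0.
  apply/eqP; apply/negP => /negP c0; apply: (z_out (\row_j (- (c ord0)^-1 * c (lift ord0 j)))).
  have -> : \row_j (- (c ord0)^-1 * c (lift ord0 j)) = - (c ord0)^-1 *: \row_j c (lift ord0 j).
    by apply/rowP => j; rewrite !mxE.
  rewrite kcombZ.
  have -> : kcomb u (\row_j c (lift ord0 j)) = - (cst (c ord0) *: z).
    apply/eqP; rewrite -addr_eq0 addrC -[X in _ == X]sum0; apply/eqP; congr (_ + _).
    by apply: eq_bigr => j _; rewrite mxE.
  by rewrite scalerN cstN scaleNr opprK scalerA -cstM mulVf // cst1 scale1r.
rewrite c0 /kscale cst0 scale0r add0r in sum0.
by move=> i; case: (unliftP ord0 i) => [j|] -> //; exact: (u_indep (fun j => c (lift ord0 j))).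
Qed.

End LinearAlgebra.

(** * Submodules generated by finite lists *)

Section Generators.
Variables (k : closedFieldType) (lambda : k) (M : gradedModule lambda).

Local Notation cst c := (toR lambda c%:MP).
Local Notation lin := (linform lambda).

(** With lists and coefficients indexed by [nat], adjoining generators is concatenation and changes
    no index type. *)
Definition genby (G : seq M) (z : M) : Prop :=
  exists c : nat -> Rf lambda, z = \sum_(i < size G) c i *: G`_i.

Lemma genby0 G : genby G 0.
Proof. by exists (fun=> 0); rewrite big1 // => i _; rewrite scale0r. Qed.

Lemma genbyD G u v : genby G u -> genby G v -> genby G (u + v).
Proof.
case=> c -> [d ->]; exists (fun i => c i + d i).
by rewrite -big_split; apply: eq_bigr => i _; rewrite scalerDl.
Qed.

Lemma genbyZ G r u : genby G u -> genby G (r *: u).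
Proof.
case=> c ->; exists (fun i => r * c i).
by rewrite gscaler_sumr; apply: eq_bigr => i _; rewrite scalerA.
Qed.

Lemma genby_sum G (I : Type) (r : seq I) (P : pred I) F :
  (forall i, P i -> genby G (F i)) -> genby G (\sum_(i <- r | P i) F i).
Proof.
move=> hF; elim/big_rec: _ => [|i z hi hz]; first exact: genby0.
by apply: genbyD => //; exact: hF.
Qed.

Lemma genby_mem G z : z \in G -> genby G z.
Proof.
move=> zG; exists (fun i => (i == index z G)%:R).
rewrite -index_mem in zG.
rewrite (bigD1 (Ordinal zG)) //= eqxx scale1r nth_index -?index_mem // big1 ?addr0 //.
by move=> i /negPf; rewrite -val_eqE /= => ->; rewrite scale0r.
Qed.

Lemma genby_cat G H z : genby G z -> genby (G ++ H) z.
Proof.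
case=> c ->; apply: genby_sum => i _; apply: genbyZ; apply: genby_mem.
by rewrite mem_cat mem_nth.
Qed.

Lemma genby_kcomb G d (u : 'I_d -> M) c : (forall i, genby G (u i)) -> genby G (kcomb u c).
Proof. by move=> hu; apply: genby_sum => i _; exact: genbyZ. Qed.

End Generators.

(** * Counting generators degree by degree: Y M lies in x M *)

Section MinimalMultiplicity.
Variables (k : closedFieldType) (lambda : k) (M : gradedModule lambda) (q : k).

Local Notation cst c := (toR lambda c%:MP).
Local Notation lin := (linform lambda).
Local Notation x := (lin 1 (- q)).
Local Notation Y := (toR lambda (pY k)).

Hypothesis x_reg : forall z : M, x *: z = 0 -> z = 0.

Lemma kindep_regular d (b : 'I_d -> M) : kindep b -> kindep (fun i => x *: b i).
Proof.
move=> b_indep c sum0; apply: b_indep; apply: x_reg.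
rewrite gscaler_sumr -[RHS]sum0; apply: eq_bigr => i _.
by rewrite /kscale !scalerA mulrC.
Qed.

Lemma kcomb_scale r d (b : 'I_d -> M) c : kcomb (fun i => r *: b i) c = r *: kcomb b c.
Proof.
rewrite gscaler_sumr; apply: eq_bigr => i _.
by rewrite /kscale !scalerA mulrC.
Qed.

Lemma gpart_kcomb n d (b : 'I_d -> M) c :
  (forall i, b i \in gpart M n) -> kcomb b c \in gpart M n.
Proof. by move=> hb; apply: gpart_sum => i _; apply: gpart_cst. Qed.

Variables (h : int -> nat) (s N : int) (m : nat).
Hypothesis hilb : hilbert_function M h.
Hypothesis h_low : forall n : int, n < s -> h n = 0%N.
Hypothesis h_high : forall n : int, N <= n -> h n = m.
Hypothesis m_min : forall e (v : 'I_e -> M), generates v -> (m <= e)%N.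

Lemma gpart_low n z : n < s -> z \in gpart M n -> z = 0.
Proof.
move=> ns zn; have := hilb n; rewrite h_low // => -[b [_ _ /(_ z zn)[c ->]]].
by rewrite big_ord0.
Qed.

(** From degree N on, multiplication by x is an injection between spaces of the same dimension m,
    hence onto. *)
Lemma gpart_high n z : N <= n -> z \in gpart M (n + 1) ->
  exists2 w, w \in gpart M n & z = x *: w.
Proof.
move=> Nn zn; have [b [bn b_indep _]] := hilb n.
have [r [w [rE span]]] := kdim_extend (hilb (n + 1)) (fun i => gpart_lin 1 (- q) (bn i))
  (kindep_regular b_indep).
have r0 : r = 0%N by move: rE; rewrite !h_high; lia.
have [c [c' ->]] := span z zn; subst r.
exists (kcomb b c); first exact: gpart_kcomb.
by rewrite kcomb_scale {2}/kcomb big_ord0 addr0.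
Qed.

(** Degree n needs at most h(n) - h(n-1) new generators, since x M_(n-1) is already generated. In
    degree n0 + 1 the vector Y z0 is generated too and lies outside x M_n0, which saves one more;
    the summand [(n0 < n)] records this saving. *)
Lemma generators_upto n0 z0 : z0 \in gpart M n0 ->
  (forall w, w \in gpart M n0 -> Y *: z0 <> x *: w) ->
  forall (d : nat) (n : int), n = s - 1 + d%:Z ->
  exists G : seq M, (size G + (n0 < n)%R <= h n)%N /\
    forall (j : int) z, j <= n -> z \in gpart M j -> genby G z.
Proof.
move=> z0n z0_out; elim=> [|d IH] n nd.
  (* In degree s - 1 and below M vanishes; n0 < s - 1 would force z0 = 0, against [z0_out]. *)
  exists [::]; split=> [|j z jn zj]; last first.
    by rewrite (@gpart_low j z) //; [exact: genby0 | lia].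
  have [n0s|//] /= := ltP n0 n.
  by case: (z0_out 0); rewrite ?gpart0 // (@gpart_low n0 z0) ?scaler0 //; lia.
have [n' n'E] : exists n' : int, n' = s - 1 + d%:Z by exists (s - 1 + d%:Z).
have nE : n = n' + 1 by lia.
have {IH}[G [sizeG genG]] := IH n' n'E.
have [b [bn b_indep b_span]] := hilb n'.
have genb i : genby G (b i) by exact: genG (bn i).
have bcomb c : genby G (kcomb b c) by exact: genby_kcomb.
(* An independent family of degree n that is already generated: the x b_i, together with Y z0 when n
   - 1 = n0. *)
have [a [u [aE u_indep un ugen]]] : exists a (u : 'I_a -> M),
    [/\ a = (h n' + (n0 == n'))%N, kindep u, forall i, u i \in gpart M n
      & forall i, genby G (u i)].
  have xbn i : x *: b i \in gpart M n by rewrite nE; apply: gpart_lin.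
  case: eqVneq => [n0E|_]; last first.
    exists (h n'), (fun i => x *: b i); rewrite addn0; split=> //; first exact: kindep_regular.
    by move=> i; apply: genbyZ.
  exists (h n').+1, (fcons (Y *: z0) (fun i => x *: b i)); split; rewrite ?addn1 //.
  + apply: kindep_cons; first exact: kindep_regular.
    by move=> c; rewrite kcomb_scale; apply: z0_out; rewrite n0E; exact: gpart_kcomb.
  + move=> i; rewrite /fcons; case: (unlift _ _) => //.
    by rewrite linY nE -n0E; apply: gpart_lin.
  + move=> i; rewrite /fcons; case: (unlift _ _) => [j|]; apply: genbyZ => //.
    by apply: (genG n0) => //; lia.
have [r [w [rE span]]] := kdim_extend (hilb n) un u_indep.
exists (G ++ codom w); split.
  rewrite size_cat size_codom card_ord -rE aE.
  have -> : (n0 < n)%R = ((n0 < n')%R + (n0 == n'))%N :> nat.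
    rewrite nE ltzD1 le_eqVlt; case: eqVneq => [->|_]; last by rewrite addn0.
    by rewrite ltxx.
  lia.
move=> j z jn zj; have [jn'|nj] := leP j n'; first by apply/genby_cat/(genG j).
have jE : j = n by lia.
rewrite jE in zj; have [c [c' ->]] := span z zj.
apply: genbyD; apply: genby_kcomb => i; first exact: genby_cat.
by apply: genby_mem; rewrite mem_cat codom_f orbT.
Qed.

(* A vector z0 with Y z0 outside x M would save a generator. *)
Lemma mulY_in_xM n z : z \in gpart M n -> exists2 w, w \in gpart M n & Y *: z = x *: w.
Proof.
move=> zn; have [//|z_out] := pselect (exists2 w, w \in gpart M n & Y *: z = x *: w).
have {}z_out w : w \in gpart M n -> Y *: z <> x *: w by move=> wn zE; apply: z_out; exists w.
(* The bound d puts t strictly above both N and n, so that h t = m and the saved generator is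
   counted. *)
pose d := (`|N - s| + `|n - s| + 2)%N.
have [t tE] : exists t : int, t = s - 1 + d%:Z by exists (s - 1 + d%:Z).
have [G [sizeG genG]] := generators_upto zn z_out tE.
(* Beyond t every vector is x times one of lower degree, so G generates M; this contradicts the
   minimality of m, as G has fewer than m elements. *)
have genM j v : v \in gpart M j -> genby G v.
  have [/genG|tj] := leP j t; first exact.
  have -> : j = t + `|j - t|%N%:Z by lia.
  elim: `|j - t|%N v => [|e IH] v vj; first by apply: genG vj; lia.
  have [||w wj ->] := @gpart_high (t + e%:Z) v; first by lia.
    by rewrite (_ : t + e%:Z + 1 = t + e.+1%:Z) //; lia.
  by apply/genbyZ/IH.
have /m_min : generates (fun i : 'I_(size G) => G`_i).
  move=> v; have [S [v_ [hv ->]]] := gpart_span v.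
  have [|c cE] := @genby_sum _ _ M G _ S predT v_; first by move=> j _; exact: genM (hv j).
  by exists (fun i => c i).
move: sizeG; rewrite h_high; last by lia.
by rewrite (_ : n < t); lia.
Qed.

End MinimalMultiplicity.

(** * Consequences of the Ulrich condition *)

Section UlrichStructure.
Variables (k : closedFieldType) (lambda : k) (M : gradedModule lambda).

Lemma laurent_coef_low s p n : n < s -> laurent_coef s p n = 0.
Proof. by rewrite /laurent_coef => ns; rewrite leNgt ns. Qed.

Lemma laurent_coef_high s (p : {poly int}) n : s + (size p)%:Z <= n -> laurent_coef s p n = p.[1].
Proof.
move=> ns; rewrite /laurent_coef ifT; last by lia.
rewrite horner_coef (@big_ord_widen _ _ _ _ `|n - s|.+1 (fun i => p`_i * 1 ^+ i)); last by lia.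
rewrite [RHS]big_mkcond; apply: eq_bigr => i _.
by rewrite expr1n mulr1; case: ltnP => // /(nth_default 0) ->.
Qed.

(** The equality mu(M) = e(M) enters here: m is both the least number of generators and the value of
    the Hilbert function in large degrees. *)
Lemma ulrich_structure (q : k) : ulrich M -> q * (q - 1) * (q - lambda) = 1 ->
  let x := linform lambda 1 (- q) in
  [/\ forall z : M, x *: z = 0 -> z = 0,
      forall n z, z \in gpart M n ->
        exists2 w, w \in gpart M n & toR lambda (pY k) *: z = x *: w,
      exists s : int, forall n z, n < s -> z \in gpart M n -> z = 0,
      exists N : int, forall n z, N <= n -> z \in gpart M (n + 1) ->
        exists2 w, w \in gpart M n & z = x *: w
    & forall n, exists d, kdim (gpart M n) d].
Proof.
move=> [M_MCM [m [[_ m_min] [h [s [p [hilb hE _ mE]]]]]]] hq x.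
have x_reg (z : M) : x *: z = 0 -> z = 0 by exact: generic_lin_regular hq.
have h_low (n : int) : n < s -> h n = 0%N.
  by move=> /(laurent_coef_low p) h0; have := hE n; rewrite h0; lia.
have h_high (n : int) : s + (size p)%:Z <= n -> h n = m.
  by move=> /laurent_coef_high h1; have := hE n; rewrite h1 -mE; lia.
split=> //.
- exact: (mulY_in_xM x_reg hilb h_low h_high m_min).
- by exists s => n z; exact: (gpart_low hilb h_low).
- by exists (s + (size p)%:Z) => n z; exact: (gpart_high x_reg hilb h_high).
- by move=> n; exists (h n); exact: hilb.
Qed.

End UlrichStructure.

(** * Splitting along coprime factors of f *)

Section Splitting.
Variables (k : closedFieldType) (lambda : k) (M : gradedModule lambda) (q : k).

Local Notation cst c := (toR lambda c%:MP).
Local Notation lin := (linform lambda).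
Local Notation x := (lin 1 (- q)).
Local Notation Y := (toR lambda (pY k)).

Hypothesis M_indec : indecomposable M.
Hypothesis x_reg : forall z : M, x *: z = 0 -> z = 0.
Hypothesis Y_div : forall n z, z \in gpart M n ->
  exists2 w, w \in gpart M n & Y *: z = x *: w.

Lemma regularX d (z : M) : x ^+ d *: z = 0 -> z = 0.
Proof.
elim: d => [|d IH]; first by rewrite expr0 scale1r.
by rewrite exprS -scalerA => /x_reg.
Qed.

Lemma regularX_inj d : injective (fun z : M => x ^+ d *: z).
Proof.
move=> u v /eqP; rewrite -subr_eq0 -scalerBr => /eqP/regularX/eqP.
by rewrite subr_eq0 => /eqP.
Qed.

(** The vector w has the degree of z: it is the value at z of the degree-preserving operator g / x^d
    when g is a form of degree d. *)
Definition divX d (g : Rf lambda) : Prop := forall n z, z \in gpart M n ->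
  exists2 w, w \in gpart M n & g *: z = x ^+ d *: w.

(** Linear forms are spanned by x and Y, and both send M_n into x M_n. *)
Lemma divX_lin a b : divX 1 (lin a b).
Proof.
move=> n z zn; have [w wn Yz] := Y_div zn.
have [|s [t ->]] := @lin_span _ lambda 1 (- q) 0 1 a b.
  by rewrite mul0r subr0 mulr1 oner_eq0.
exists (cst s *: z + cst t *: w); first by apply: gpartD; apply: gpart_cst.
rewrite scalerDl -!scalerA -linY Yz expr1 scalerDr !scalerA.
by congr (_ *: _ + _ *: _); rewrite mulrC.
Qed.

Lemma divXM d e g g' : divX d g -> divX e g' -> divX (d + e) (g * g').
Proof.
move=> hg hg' n z zn; have [w wn wE] := hg' n z zn; have [w' wn' wE'] := hg n w wn.
by exists w' => //; rewrite -scalerA wE scalerA mulrC -scalerA wE' scalerA -exprD addnC.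
Qed.

(** Comaximality of g and l after inverting x. The coefficient of g is constant so that multiplying
    by it preserves degrees. *)
Definition comaxX d (g l : Rf lambda) : Prop :=
  exists a r, x ^+ d = cst a * g + r * l.

(** In the product of the two relations every term except a a' g g' is divisible by l. *)
Lemma comaxXM d e g g' l : comaxX d g l -> comaxX e g' l -> comaxX (d + e) (g * g') l.
Proof.
case=> a [r gE] [a' [r' gE']]; exists (a * a'), (cst a * g * r' + r * (cst a' * g' + r' * l)).
by rewrite exprD gE gE' cstM; ring.
Qed.

Lemma ann_homog_submodule g : homog_submodule (fun n (z : M) => z \in gpart M n /\ g *: z = 0).
Proof.
split=> [n z []//|n|n u v [un gu] [vn gv]|n c z [zn gz]|n a b z [zn gz]].
- by rewrite gpart0 scaler0.
- by rewrite gpartD // scalerDr gu gv addr0.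
- by rewrite gpart_cst // scalerA mulrC -scalerA gz scaler0.
- by rewrite gpart_lin // scalerA mulrC -scalerA gz scaler0.
Qed.

(* As g z = x^d w, the relation x^d = a g + r l gives z = a w + (z - a w), with a w
   killed by l and z - a w killed by g. *)
Lemma comax_split d g l : divX d g -> comaxX d g l -> (forall z : M, (l * g) *: z = 0) ->
  (forall n z, z \in gpart M n -> l *: z = 0) \/ (forall n z, z \in gpart M n -> g *: z = 0).
Proof.
move=> hg [a [r xE]] lg0.
have xdE (z : M) : x ^+ d *: z = cst a *: (g *: z) + r *: (l *: z).
  by rewrite xE scalerDl -!scalerA.
have cover n z : z \in gpart M n -> exists z1 z2,
    [/\ z1 \in gpart M n /\ l *: z1 = 0, z2 \in gpart M n /\ g *: z2 = 0 & z = z1 + z2].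
  move=> zn; have [w wn gz] := hg n z zn; pose w' := cst a *: w.
  have xw' : x ^+ d *: w' = cst a *: (g *: z) by rewrite gscalerC -gz.
  have w'n : w' \in gpart M n by exact: gpart_cst.
  (* Both annihilations are tested after multiplying by x^d, where they reduce to l g = 0 on M. *)
  exists w', (z - w'); rewrite addrCA subrr addr0 gpartB //; do 2![split=> //]; apply: (@regularX d).
    by rewrite gscalerC xw' gscalerC (scalerA l) lg0 scaler0.
  by rewrite gscalerC scalerBr xw' xdE addrAC subrr add0r gscalerC (scalerA g) mulrC lg0 scaler0.
have [|n z [zn lz] [_ gz]|H|H] := homog_indecomposable M_indec
  (ann_homog_submodule l) (ann_homog_submodule g).
- exact: cover.
- by apply: (@regularX d); rewrite xdE lz gz !scaler0 addr0.
- right=> n z /cover[z1 [z2 [/H -> [_ gz2] ->]]]; by rewrite add0r.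
- left=> n z /cover[z1 [z2 [[_ lz1] /H -> ->]]]; by rewrite addr0.
Qed.

Lemma gpart_ann (r : Rf lambda) : (forall n z, z \in gpart M n -> r *: z = 0) ->
  forall z : M, r *: z = 0.
Proof.
move=> H z; have [s [z_ [zP ->]]] := gpart_span z.
by rewrite gscaler_sumr big1 // => n _; exact: H (zP n).
Qed.

Hypothesis lambda_neq0 : lambda != 0.
Hypothesis lambda_neq1 : lambda != 1.
Local Notation L i := (toR lambda (pl lambda i)).

Lemma comaxX_forms i j : i != j -> comaxX 1 (L j) (L i).
Proof.
move=> ij; have := form_coeffs_det lambda_neq0 lambda_neq1 ij.
rewrite /coeff_det => /(lin_span lambda 1 (- q))[s [t xE]].
by exists t, (cst s); rewrite expr1 xE !toR_pl addrC.
Qed.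

(** The factors are peeled off one at a time: l_1 against l_2 l_3 l_4, then l_2 against l_3 l_4,
    then l_3 against l_4. *)
Lemma form_kills : exists i, forall z : M, L i *: z = 0.
Proof.
have D i : divX 1 (L i) by rewrite toR_pl; exact: divX_lin.
have F : L 0%R * (L 1%R * (L 2%:R * L 3%:R)) = 0.
  rewrite -(toR_pf lambda) !big_ord_recr big_ord0 /= mul1r !mulrA.
  by congr (L _ * L _ * L _ * L _); apply: val_inj.
have C := comaxX_forms.
case: (@comax_split (1 + (1 + 1)) (L 1%R * (L 2%:R * L 3%:R)) (L 0%R)) =>
  [|||/gpart_ann H|/gpart_ann H].
- exact: divXM (D _) (divXM (D _) (D _)).
- by apply: comaxXM (C _ _ _) (comaxXM (C _ _ _) (C _ _ _)).
- by move=> z; rewrite F scale0r.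
- by exists 0%R.
case: (@comax_split (1 + 1) (L 2%:R * L 3%:R) (L 1%R)) => [||//|/gpart_ann H'|/gpart_ann H'].
- exact: divXM (D _) (D _).
- by apply: comaxXM (C _ _ _) (C _ _ _).
- by exists 1%R.
case: (@comax_split 1 (L 3%:R) (L 2%:R)) => [||//|/gpart_ann H''|/gpart_ann H''].
- exact: D.
- exact: C.
- by exists 2%:R.
- by exists 3%:R.
Qed.

End Splitting.

(** * Modules on which every linear form is a multiple of x *)

Section RankOne.
Variables (k : closedFieldType) (lambda : k) (M : gradedModule lambda) (q : k).

Local Notation cst c := (toR lambda c%:MP).
Local Notation lin := (linform lambda).
Local Notation x := (lin 1 (- q)).

(** H is the kernel of a coordinate that does not vanish at v. *)
Lemma hyperplane n d v : kdim (gpart M n) d -> v \in gpart M n -> v <> 0 ->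
  exists H : M -> Prop,
    [/\ forall h, H h -> h \in gpart M n,
        [/\ H 0, forall g h, H g -> H h -> H (g + h) & forall c h, H h -> H (cst c *: h)],
        forall z, z \in gpart M n -> exists c, H (z - cst c *: v)
      & forall c, H (cst c *: v) -> c = 0].
Proof.
move=> [b [bn b_indep b_span]] vn v0.
have span z : z \in gpart M n -> exists c, z = kcomb b c.
  by move=> /b_span[c ->]; exists (\row_i c i); apply: eq_bigr => i _; rewrite mxE.
have [a aE] := span v vn.
have [j aj] : exists j, a 0 j != 0.
  apply/existsP; apply: contraPT v0 => /existsPn a0 v0; apply: v0.
  rewrite aE (_ : a = 0) ?kcomb0 //; apply/rowP => j.
  by rewrite mxE; apply/eqP; have := a0 j; rewrite negbK.
exists (fun h => exists2 c : 'rV_d, c 0 j = 0 & h = kcomb b c); split.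
- by move=> h [c _ ->]; exact: gpart_kcomb.
- split; first by exists 0; rewrite ?kcomb0 // mxE.
    by move=> _ _ [c cj ->] [c' cj' ->]; exists (c + c'); rewrite ?kcombD // mxE cj cj' addr0.
  by move=> e _ [c cj ->]; exists (e *: c); rewrite ?kcombZ // mxE cj mulr0.
- move=> z /span[c ->]; exists (c 0 j / a 0 j).
  exists (c - (c 0 j / a 0 j) *: a); first by rewrite !mxE divfK ?subrr.
  by rewrite aE -kcombZ kcombB.
- move=> c [e ej]; rewrite aE -kcombZ => /eqP; rewrite -subr_eq0 -kcombB.
  move=> /eqP/(kcomb_ker b_indep)/rowP/(_ j)/eqP.
  by rewrite !mxE ej subr0 mulf_eq0 (negPf aj) orbF => /eqP.
Qed.

Lemma exists_lowest (s : int) : (exists z : M, z <> 0) ->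
  (forall n z, n < s -> z \in gpart M n -> z = 0) ->
  exists n0 v, [/\ v \in gpart M n0, v <> 0
    & forall n z, n < n0 -> z \in gpart M n -> z = 0].
Proof.
move=> [z z0] low.
pose P (d : nat) := `[< exists2 v, v \in gpart M (s + d%:Z) & v <> 0 >].
have exP : exists d, P d.
  apply: contra_notP z0 => noP; have [S [z_ [zP ->]]] := gpart_span z.
  rewrite big1 // => n _; apply: contra_notP noP => zn0.
  have [ns|sn] := ltP n s; first by case: zn0; exact: low (zP n).
  exists `|n - s|%N; apply/asboolP; exists (z_ n) => //.
  by rewrite (_ : s + `|n - s|%N%:Z = n) //; lia.
case: (ex_minnP exP) => d /asboolP[v vn v0] d_min.
exists (s + d%:Z), v; split=> // n w nd wn.
have [ns|sn] := ltP n s; first exact: low wn.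
(* By contradiction: a nonzero w of degree below s + d violates the minimality of d. *)
apply: contra_notP (negP (isT : ~~ false)) => w0.
suff /d_min : P `|n - s|%N by lia.
by apply/asboolP; exists w => //; rewrite (_ : s + `|n - s|%N%:Z = n) //; lia.
Qed.

Hypothesis M_indec : indecomposable M.
Hypothesis x_reg : forall z : M, x *: z = 0 -> z = 0.
Hypothesis lin_x : forall a b, exists t, forall z : M, lin a b *: z = cst t *: (x *: z).

Local Notation regX := (@regularX _ _ M q x_reg).

Lemma exprD_scale a b (z : M) : x ^+ a *: (x ^+ b *: z) = x ^+ (a + b) *: z.
Proof. by rewrite scalerA exprD. Qed.

(* The degree-n part of the x-saturation of R S, for a subspace S of M_N. *)
Definition saturation (N : int) (S : M -> Prop) (n : int) (z : M) : Prop :=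
  z \in gpart M n /\ exists (a b : nat) h,
    [/\ S h, n + a%:Z = N + b%:Z & x ^+ a *: z = x ^+ b *: h].

(** Sums are brought to a common power of x, and by [lin_x] a linear form acts as a constant times
    x. *)
Lemma saturation_homog_submodule (N : int) (S : M -> Prop) :
  S 0 -> (forall g h, S g -> S h -> S (g + h)) -> (forall c h, S h -> S (cst c *: h)) ->
  homog_submodule (saturation N S).
Proof.
move=> S0 SD SC; split=> [n z []//|n|n u v|n c z|n a b z].
- split; first exact: gpart0.
  have [a [b abE]] : exists a b : nat, n + a%:Z = N + b%:Z.
    have [nN|Nn] := leP n N; first by exists `|N - n|%N, 0%N; lia.
    by exists 0%N, `|n - N|%N; lia.
  by exists a, b, 0; rewrite !scaler0.
- move=> [un [a [b [h [Sh nE uE]]]]] [vn [a' [b' [h' [Sh' nE' vE]]]]].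
  split; first exact: gpartD.
  exists (a + a')%N, (a' + b)%N, (h + h'); split; [exact: SD | lia |].
  rewrite !scalerDr addnC -exprD_scale uE exprD_scale; congr (_ + _).
  by rewrite addnC -exprD_scale vE exprD_scale; congr (_ ^+ _ *: _); lia.
- move=> [zn [a [b [h [Sh nE zE]]]]]; split; first exact: gpart_cst.
  by exists a, b, (cst c *: h); split=> //; [exact: SC | rewrite gscalerC zE gscalerC].
- move=> [zn [e [f [h [Sh nE zE]]]]]; split; first exact: gpart_lin.
  have [t ->] := lin_x a b.
  exists e, f.+1, (cst t *: h); split; [exact: SC | lia |].
  rewrite gscalerC [RHS]gscalerC; congr (_ *: _).
  by rewrite gscalerC zE scalerA -exprS.
Qed.

(** Clearing powers of x in the two relations gives x^m h = x^m h' for some m, and x is injective,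
    so h = h' lies in both subspaces. *)
Lemma saturation_disjoint (N : int) (S T : M -> Prop) n z :
  (forall h, S h -> T h -> h = 0) -> saturation N S n z -> saturation N T n z -> z = 0.
Proof.
move=> ST0 [_ [a [b [h [Sh nE zE]]]]] [_ [a' [b' [h' [Th' nE' zE']]]]].
have hh' : h = h'.
  apply: (@regularX_inj _ _ M q x_reg (a' + b)%N); rewrite /= -exprD_scale -zE.
  by rewrite exprD_scale addnC -exprD_scale zE' exprD_scale; congr (_ ^+ _ *: _); lia.
by subst h'; apply: (regX (d := a)); rewrite zE (ST0 h) // scaler0.
Qed.

Variables (s N0 : int).
Hypothesis low : forall n z, n < s -> z \in gpart M n -> z = 0.
Hypothesis high : forall n z, N0 <= n -> z \in gpart M (n + 1) ->
        exists2 w, w \in gpart M n & z = x *: w.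
Hypothesis fin : forall n, exists d, kdim (gpart M n) d.

Lemma highX (n : int) (d : nat) z : N0 <= n -> z \in gpart M (n + d%:Z) ->
  exists2 w, w \in gpart M n & z = x ^+ d *: w.
Proof.
move=> Nn; elim: d z => [|d IH] z zn.
  by exists z; rewrite ?expr0 ?scale1r // -[n]addr0.
have [||w wn ->] := @high (n + d%:Z) z; first by lia.
  by rewrite (_ : n + d%:Z + 1 = n + d.+1%:Z) //; lia.
have [u un ->] := IH w wn.
by exists u => //; rewrite exprS scalerA.
Qed.

Lemma rank_one : exists n0 (v : M), [/\ v \in gpart M n0, v <> 0 &
  forall n z, z \in gpart M n ->
    z = 0 \/ exists c (d : nat), n = n0 + d%:Z /\ z = cst c *: (x ^+ d *: v)].
Proof.
have [n0 [v [vn v0 below]]] := exists_lowest M_indec.1 low.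
exists n0, v; split=> //.
(* N is at least N0, so x is onto from degree N on, and at least n0, so v can be pushed up into
   M_N. *)
pose e := `|N0 - n0|%N; have [N NE] : exists N : int, N = n0 + e%:Z by exists (n0 + e%:Z).
pose v' := x ^+ e *: v.
have v'n : v' \in gpart M N by rewrite NE; exact: gpart_linX.
have v'0 : v' <> 0 by move=> /regX.
have [d0 dimN] := fin N.
have [H [HN [H0 HD HC] Hspan Hv]] := hyperplane dimN v'n v'0.
pose S h := exists c, h = cst c *: v'.
have S0 : S 0 by exists 0; rewrite cst0 scale0r.
have hS : homog_submodule (saturation N S).
  apply: saturation_homog_submodule => //.
    by move=> _ _ [c ->] [c' ->]; exists (c + c'); rewrite cstD scalerDl.
  by move=> c _ [c' ->]; exists (c * c'); rewrite cstM scalerA.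
have hH : homog_submodule (saturation N H) by exact: saturation_homog_submodule.
have ST0 h : S h -> H h -> h = 0 by move=> [c ->] /Hv ->; rewrite cst0 scale0r.
have cover n z : z \in gpart M n -> exists z1 z2,
    [/\ saturation N S n z1, saturation N H n z2 & z = z1 + z2].
  move=> zn; have [nn0|n0n] := ltP n n0.
    rewrite (below _ _ nn0 zn); exists 0, 0; split; last by rewrite addr0.
      by have [] := hS.
    by have [] := hH.
  (* Up to degree N, z is pushed into M_N and split there; since n is at least n0, the multiple of
     v' lifts to x^b v in degree n. Above N, z is first divided by a power of x. *)
  have [nN|Nn] := leP n N.
    pose a := `|N - n|%N; pose b := `|n - n0|%N.
    have xz : x ^+ a *: z \in gpart M N.
      by rewrite (_ : N = n + a%:Z); [exact: gpart_linX | lia].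
    have [c Hc] := Hspan _ xz.
    have vb : x ^+ a *: (x ^+ b *: v) = v' by rewrite exprD_scale /v'; congr (_ ^+ _ *: _); lia.
    have bn : x ^+ b *: v \in gpart M n.
      by rewrite (_ : n = n0 + b%:Z); [exact: gpart_linX | lia].
    exists (cst c *: (x ^+ b *: v)), (z - cst c *: (x ^+ b *: v)).
    split; last by rewrite addrCA subrr addr0.
      split; first exact: gpart_cst.
      by exists a, 0%N, (cst c *: v'); split; [exists c | lia | rewrite expr0 scale1r gscalerC vb].
    split; first by rewrite gpartB ?gpart_cst.
    exists a, 0%N, (x ^+ a *: z - cst c *: v'); split=> //; first by lia.
    by rewrite expr0 scale1r scalerBr gscalerC vb.
  pose b := `|n - N|%N; have nE : n = N + b%:Z by lia.
  rewrite nE in zn *; have [|w wn ->] := @highX N b z _ zn; first by lia.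
  have [c Hc] := Hspan _ wn.
  exists (x ^+ b *: (cst c *: v')), (x ^+ b *: (w - cst c *: v')); split.
  - split; first by apply: gpart_linX; apply: gpart_cst.
    by exists 0%N, b, (cst c *: v'); split; [exists c | lia | rewrite expr0 scale1r].
  - split; first by apply: gpart_linX; rewrite gpartB ?gpart_cst.
    by exists 0%N, b, (w - cst c *: v'); split; [ | lia | rewrite expr0 scale1r].
  - by rewrite -scalerDr addrCA subrr addr0.
have [|S_0|H_0] := homog_indecomposable M_indec hS hH cover.
- by move=> n z; exact: saturation_disjoint.
(* The saturation of k v' contains v, so it is the other summand that vanishes. *)
- case: v0; apply: (S_0 n0); split=> //; exists e, 0%N, v'; split; last by rewrite expr0 scale1r.
    by exists 1; rewrite cst1 scale1r.
  by lia.
move=> n z zn; have [nn0|n0n] := ltP n n0; first by left; exact: below zn.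
right; have [z1 [z2 [[z1n [a [b [_ [[c ->] nE zE]]]]] /H_0 -> ->]]] := cover n z zn.
exists c, `|n - n0|%N; split; first by lia.
apply: (@regularX_inj _ _ M q x_reg a); rewrite addr0 zE gscalerC [RHS]gscalerC.
by rewrite !exprD_scale; congr (_ *: (_ ^+ _ *: _)); lia.
Qed.

End RankOne.

(** Equal annihilators make r v -> r w independent of the coefficient chosen for each vector. *)
Lemma cyclic_iso (R : comNzRingType) (M N : lmodType R) (v : M) (w : N) :
  (forall z, exists r, z = r *: v) -> (forall z, exists r, z = r *: w) ->
  (forall r, r *: v = 0 <-> r *: w = 0) ->
  exists phi : {linear M -> N}, bijective phi /\ forall r, phi (r *: v) = r *: w.
Proof.
move=> /choice[f fE] /choice[g gE] ann.
have transfer r s : r *: v = s *: v -> r *: w = s *: w.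
  by move=> /eqP; rewrite -subr_eq0 -scalerBl => /eqP/ann/eqP; rewrite scalerBl subr_eq0 => /eqP.
have transfer' r s : r *: w = s *: w -> r *: v = s *: v.
  by move=> /eqP; rewrite -subr_eq0 -scalerBl => /eqP/ann/eqP; rewrite scalerBl subr_eq0 => /eqP.
pose phi z := f z *: w.
have phiE r : phi (r *: v) = r *: w by apply: transfer; rewrite -fE.
have phi_linear : linear phi.
  by move=> a y z; rewrite {1}(fE y) {1}(fE z) scalerA -scalerDl phiE scalerDl -scalerA.
pose F : {linear M -> N} := HB.pack phi (GRing.isLinear.Build R M N *:%R phi phi_linear).
exists F; split; last exact: phiE.
exists (fun z => g z *: v) => [z|z]; last by rewrite [LHS]phiE -gE.
by rewrite [RHS]fE; apply: transfer'; rewrite -gE.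
Qed.

(** * Identification with a shift of L_i *)

Section CyclicCase.
Variables (k : closedFieldType) (lambda : k) (q : k) (i : 'I_4).
Hypothesis q_generic : q * (q - 1) * (q - lambda) = 1.

Local Notation cst c := (toR lambda c%:MP).
Local Notation lin := (linform lambda).
Local Notation x := (lin 1 (- q)).
Local Notation l := (toR lambda (pl lambda i)).

(** For i = 1, ..., 4 the determinant is q, 1, q - 1 and q - lambda; the product being 1, none
    vanishes. *)
Lemma generic_det : coeff_det (1, - q) (form_coeffs lambda i) != 0.
Proof.
have : q * (q - 1) * (q - lambda) != 0 by rewrite q_generic oner_eq0.
rewrite !mulf_eq0 !negb_or => /andP[/andP[q0 q1] ql].
rewrite /coeff_det /form_coeffs; case: i => -[|[|[|[|//]]]] ? /=; rewrite /tnth /=.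
- by rewrite mulr0 mul1r opprK add0r.
- by rewrite mul0r subr0 mulr1 oner_eq0.
- by rewrite !mul1r opprK addrC.
- by rewrite !mul1r opprK addrC.
Qed.

Lemma lin_mod_form (M : gradedModule lambda) : (forall z : M, l *: z = 0) ->
  forall a b, exists t, forall z : M, lin a b *: z = cst t *: (x *: z).
Proof.
move=> lM a b; have := generic_det; rewrite /coeff_det => /(lin_span lambda a b)[t [u E]].
exists t => z; rewrite E scalerDl -toR_pl -[X in _ + X]scalerA lM scaler0 addr0.
by rewrite scalerA.
Qed.

Local Notation proj1 := (cyclic_proj l 1 : L_ lambda i).

Lemma scale_proj1 r : r *: proj1 = cyclic_proj l r.
Proof. by rewrite [LHS]cyclic_scaleE mulr1. Qed.

Lemma form_kills_L (z : L_ lambda i) : l *: z = 0.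
Proof.
have [r ->] := cyclic_proj_surj z; rewrite [LHS]cyclic_scaleE -[RHS]cyclic_proj0.
by apply/cyclic_proj_eq/principalP; exists r; rewrite subr0 mulrC.
Qed.

Definition evx (P : {poly k}) : Rf lambda :=
  (map_poly (toR lambda \o @mpolyC 2 k) P).[x].

Lemma evxE P : evx P = \sum_(j < size P) cst P`_j * x ^+ j.
Proof.
rewrite /evx (@horner_coef_wide _ (size P)); last exact: size_poly.
by apply: eq_bigr => j _; rewrite coef_map.
Qed.

(** Modulo l_i each linear form is a constant times x, so k[x] maps onto R/(l_i). *)
Lemma poly_in_x r : exists P, r *: proj1 = evx P *: proj1.
Proof.
apply: (scale_closed (N := fun z => exists P, z = evx P *: proj1)).
- by exists 0; rewrite /evx rmorph0 horner0 scale0r.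
- by move=> _ _ [P ->] [Q ->]; exists (P + Q); rewrite /evx rmorphD hornerD scalerDl.
- by move=> c _ [P ->]; exists (c%:P * P); rewrite /evx rmorphM /= map_polyC hornerCM scalerA.
- move=> a b _ [P ->]; have [t ->] := lin_mod_form form_kills_L a b.
  by exists (t%:P * 'X * P); rewrite /evx !rmorphM /= map_polyC map_polyX !hornerE !scalerA.
- by exists 1; rewrite /evx rmorph1 hornerE scale1r.
Qed.

Variable M : gradedModule lambda.
Hypothesis x_reg : forall z : M, x *: z = 0 -> z = 0.
Hypothesis l_kills : forall z : M, l *: z = 0.

(** The terms of P(x) v have distinct degrees n0 + j, so each vanishes, and x is regular. *)
Lemma evx_ann n0 (v : M) P : v \in gpart M n0 -> v <> 0 -> evx P *: v = 0 -> P = 0.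
Proof.
move=> vn v0; rewrite evxE scaler_suml => sum0.
have cst_reg c (z : M) : cst c *: z = 0 -> z <> 0 -> c = 0.
  move=> cz z0; apply/eqP; apply/negP => /negP c0; apply: z0.
  by rewrite -[z]scale1r -(cst1 lambda) -(mulVf c0) cstM -scalerA cz scaler0.
apply/polyP => j; rewrite coef0.
have [jP|] := ltnP j (size P); last exact: nth_default.
(* [gpart_direct] takes a family over all degrees; it is extended by 0 below n0. *)
pose z_ (n : int) : M := if n0 <= n then cst P`_(`|n - n0|%N) *: (x ^+ `|n - n0|%N *: v) else 0.
have z_E (e : nat) : z_ (n0 + e%:Z) = cst P`_e *: (x ^+ e *: v).
  by rewrite /z_ ifT; [rewrite (_ : `|_|%N = e) //; lia | lia].
have := @gpart_direct _ _ M [seq n0 + e%:Z | e <- index_iota 0 (size P)] z_ _ _ _ (n0 + j%:Z).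
rewrite z_E => H; apply: (cst_reg _ (x ^+ j *: v)); last by move=> /(regularX x_reg).
apply: H.
- by rewrite map_inj_uniq ?iota_uniq // => a b; lia.
- move=> n; rewrite /z_; case: leP => n0n; last exact: gpart0.
  apply: gpart_cst; rewrite (_ : n = n0 + `|n - n0|%N%:Z); last by lia.
  rewrite (_ : n0 + _ - n0 = `|n - n0|%N%:Z); last by lia.
  exact: gpart_linX.
- rewrite big_map big_mkord -[RHS]sum0.
  by apply: eq_bigr => e _; rewrite z_E scalerA.
- by apply/mapP; exists j => //; rewrite mem_index_iota.
Qed.

Lemma iso_shift_L n0 (v : M) : v \in gpart M n0 -> v <> 0 ->
  (forall n z, z \in gpart M n ->
    z = 0 \/ exists c (d : nat), n = n0 + d%:Z /\ z = cst c *: (x ^+ d *: v)) ->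
  graded_iso M (shift (L_ lambda i) (- n0)).
Proof.
move=> vn v0 span.
have [phi [phi_bij phiE]] : exists phi : {linear M -> L_ lambda i},
    bijective phi /\ forall r, phi (r *: v) = r *: proj1.
  apply: cyclic_iso.
  - move=> z; have [s [z_ [zP ->]]] := gpart_span z.
    elim/big_rec: _ => [|n u _ [r ->]]; first by exists 0; rewrite scale0r.
    have [->|[c [d [_ ->]]]] := span n _ (zP n); first by exists r; rewrite add0r.
    by exists (cst c * x ^+ d + r); rewrite scalerDl scalerA.
  - by move=> z; have [r ->] := cyclic_proj_surj z; exists r; rewrite scale_proj1.
  - have ann r : r *: proj1 = 0 -> r *: v = 0.
      rewrite scale_proj1 -cyclic_proj0 => /cyclic_proj_eq/principalP[b].
      by rewrite subr0 => ->; rewrite -scalerA l_kills scaler0.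
    move=> r; split=> [rv|]; last exact: ann.
    (* As r - P(x) kills the class of 1, it is a multiple of l_i and kills v; hence P(x) v = 0 and P
       = 0. *)
    have [P rP] := poly_in_x r; suff P0 : P = 0 by rewrite rP P0 /evx rmorph0 horner0 scale0r.
    apply: (evx_ann vn v0); have := ann (r - evx P).
    by rewrite !scalerBl rP subrr rv sub0r => /(_ erefl)/eqP; rewrite oppr_eq0 => /eqP.
exists phi; split=> // n z; apply/idP/idP => [zn|].
  have [->|[c [d [nE ->]]]] := span n z zn; first by rewrite linear0; exact: gpart0.
  rewrite scalerA phiE -scalerA.
  have one0 : proj1 \in gpart (L_ lambda i) 0.
    by apply/LpartP; exists 1; [exact: dhomog1 | rewrite rmorph1].
  have := gpart_cst c (gpart_linX 1 (- q) d one0).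
  by rewrite (_ : 0 + d%:Z = - n0 + n) //; lia.
rewrite /= /shift_part.
have phi_inj := bij_inj phi_bij.
(* A [Negz] degree is one where L_i is zero. *)
case E : (- n0 + n) => [d|d]; last first.
  move=> /eqP phiz; have -> : z = 0 by apply: phi_inj; rewrite linear0.
  exact: gpart0.
move=> /LpartP[p hp pE]; have -> : z = toR lambda p *: v.
  by apply: phi_inj; rewrite phiE scale_proj1.
rewrite (_ : n = d%:Z + n0); last by lia.
by apply: gpart_scale => //; apply/RpartP; exists p.
Qed.

End CyclicCase.

Theorem theorem5p4 (k : closedFieldType) (lambda : k)
    (lambda_neq0 : lambda != 0) (lambda_neq1 : lambda != 1)
    (M : gradedModule lambda)
    (M_indecomposable : indecomposable M) (M_ulrich : ulrich M) :
  exists (n : int) (i : 'I_4), graded_iso M (shift (L_ lambda i) n).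
Proof.
have [q q_generic] := exists_generic_slope lambda.
have [x_reg Y_div [s low] [N high] fin] := ulrich_structure M_ulrich q_generic.
have [i l_kills] := form_kills M_indecomposable x_reg Y_div lambda_neq0 lambda_neq1.
have lin_x := lin_mod_form q_generic l_kills.
have [n0 [v [vn v0 span]]] := rank_one M_indecomposable x_reg lin_x low high fin.
(* In L_i(-n0) the class of 1 has degree n0, the degree of v. *)
by exists (- n0), i; exact: (iso_shift_L q_generic x_reg l_kills vn v0 span).
Qed.
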